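(* Let $\alpha\in(0,1]$ and let $\mathcal C=(\mathcal C_t)_{t\ge0}$ be a candidate-family process. The following are equivalent: (i) $\mathcal C$ controls simultaneous SupFDR at level $\alpha$; (ii) there exists a future-extension coherent, time-monotone dynamic intersection $e$-process collection $\mathbf E$ such that $\mathcal C_t\subseteq\mathfrak R_{\alpha,t}(\mathbf E)$ for every $t$. Moreover, every collection $\mathbf E$ as in (ii) generates setwise persistent closure families, i.e. pointwise on $\Omega$, $\mathfrak R_{\alpha,t}(\mathbf E)\subseteq\mathfrak R_{\alpha,u}(\mathbf E)$ whenever $t\le u$.
   Context: Let $(\Omega,\mathcal F,(\mathcal F_t)_{t\in\mathbb N_0})$ be a discrete-time filtered measurable space, $\mathcal M$ a family of probability measures on $(\Omega,\mathcal F)$, $\mathcal I\subseteq\mathbb N$ an index set (finite or infinite), and $H_i\subseteq\mathcal M$, $i\in\mathcal I$, null hypotheses. Put $\mathcal N(P)=\{i\in\mathcal I:P\in H_i\}$ and, for finite $S\subseteq\mathcal I$, $H_S=\bigcap_{i\in S}H_i$ (with $H_\varnothing=\mathcal M$). The active sets $I_t\subseteq\mathcal I$ are deterministic and finite with $I_0\subseteq I_1\subseteq\cdots$ and $\bigcup_t I_t=\mathcal I$. For a finite $R\subseteq\mathcal I$ and any $S\subseteq\mathcal I$, $\mathrm{FDP}_S(R)=|S\cap R|/(|R|\vee 1)$. A candidate-family process $\mathcal C=(\mathcal C_t)_{t\ge0}$ consists of nonempty random families $\mathcal C_t\subseteq 2^{I_t}$ with $\{R\in\mathcal C_t\}\in\mathcal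 F_t$ for every deterministic $R\subseteq I_t$. It controls simultaneous SupFDR at level $\alpha$ if $\mathbb E_P[\sup_{t\ge0}\max_{R\in\mathcal C_t}\mathrm{FDP}_{\mathcal N(P)\cap I_t}(R)]\le\alpha$ for every $P\in\mathcal M$. A nonnegative $(\mathcal F_t)$-adapted process $E=(E_t)_{t\ge0}$ is an $e$-process for $H\subseteq\mathcal M$ if $\mathbb E_P[E_\tau]\le1$ for every $P\in H$ and every $(\mathcal F_t)$-stopping time $\tau$ with $P(\tau<\infty)=1$. A dynamic intersection $e$-process collection is a family $\mathbf E=(E^S_t)_{t\ge0,\ S\subseteq\mathcal I,\ 0<|S|<\infty}$ such that $E^S=(E^S_t)_{t\ge0}$ is an $e$-process for $H_S$ for each nonempty finite $S$. It is future-extension coherent if, pointwise on $\Omega$, $E_t^{S\cap I_t}\le E_t^S$ for every $t$ and every finite $S$ with $S\cap I_t\ne\varnothing$. It is time-monotone if, pointwise on $\Omega$, $E^S_t\le E^S_u$ for all $t\le u$ and every finite nonempty $S$. The closure family at time $t$ is $\mathfrak R_{\alpha,t}(\mathbf E)=\{R\subseteq I_t:\ \mathrm{FDP}_S(R)\le\alpha E^S_t\text{ for every nonempty }S\subseteq I_t\}$. *)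

(* Defs.v *)
From HB Require Import structures.
From mathcomp Require Import all_boot all_order all_algebra finmap.
From mathcomp Require Import all_classical all_reals all_analysis.

Set Implicit Arguments.
Unset Strict Implicit.
Unset Printing Implicit Defensive.

Import Order.TTheory GRing.Theory Num.Theory.

Local Open Scope classical_set_scope.
Local Open Scope ring_scope.

Definition is_filtration d (T : measurableType d) (F : nat -> set (set T)) :=
  [/\ forall t, sigma_algebra [set: T] (F t),
      forall t, F t `<=` measurable
    & forall t u, (t <= u)%N -> F t `<=` F u].

Definition adapted d (T : measurableType d) (R : realType)
    (F : nat -> set (set T)) (X : nat -> T -> R) :=
  forall t (B : set R), measurable B -> F t (X t @^-1` B).

(* Random times take values in nat extended by [None], standing for infinity. *)
Definition stopping_time d (T : measurableType d) (F : nat -> set (set T))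
    (tau : T -> option nat) :=
  forall t, F t [set w | exists2 s, tau w = Some s & (s <= t)%N].

(* The value 0 where [tau] is infinite is a convention: below, [tau] is always
   almost surely finite. *)
Definition stopped (T : Type) (R : realType) (X : nat -> T -> R)
    (tau : T -> option nat) (w : T) : R :=
  if tau w is Some t then X t w else 0.

Definition e_process d (T : measurableType d) (R : realType)
    (F : nat -> set (set T)) (H : set (probability T R))
    (X : nat -> T -> R) :=
  [/\ forall t w, 0 <= X t w,
      adapted F X
    & forall (P : probability T R) (tau : T -> option nat),
        H P -> stopping_time F tau ->
        P [set w | tau w <> None] = 1%E ->
        ('E_P[stopped X tau] <= 1)%E].

Definition true_nulls d (T : measurableType d) (R : realType)
    (I : set nat) (H : nat -> set (probability T R)) (P : probability T R) :
    set nat :=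
  [set i | I i /\ H i P].

Definition intersection_null d (T : measurableType d) (R : realType)
    (M : set (probability T R)) (H : nat -> set (probability T R))
    (S : {fset nat}) : set (probability T R) :=
  [set P | M P /\ forall i, i \in S -> H i P].

Definition FDP {R : realType} (S : set nat) (A : {fset nat}) : R :=
  #|` [fset i in A | i \in S]%fset |%:R / (maxn #|` A| 1)%:R.

Definition candidate_family_process d (T : measurableType d)
    (F : nat -> set (set T)) (Iact : nat -> {fset nat})
    (C : nat -> T -> {fset {fset nat}}) :=
  [/\ forall t w, C t w != fset0%fset,
      forall t w A, A \in C t w -> (A `<=` Iact t)%fset
    & forall t A, (A `<=` Iact t)%fset -> F t [set w | A \in C t w]].

(* As the false discovery proportion is nonnegative and candidate families are
   nonempty, taking 0 as the unit of the finite maximum is harmless. *)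
Definition max_FDP {R : realType} (S : set nat) (Cw : {fset {fset nat}}) : R :=
  \big[Num.max/0]_(A <- Cw) FDP S A.

Definition controls_SupFDR d (T : measurableType d) (R : realType)
    (M : set (probability T R)) (I : set nat)
    (H : nat -> set (probability T R)) (Iact : nat -> {fset nat})
    (C : nat -> T -> {fset {fset nat}}) (alpha : R) :=
  forall P : probability T R, M P ->
    (\int[P]_w ereal_sup (range (fun t =>
        (max_FDP (true_nulls I H P `&` [set` Iact t]) (C t w))%:E))
     <= alpha%:E)%E.

(* A collection (E^S_t) indexed by the nonempty finite subsets S of I is
   represented by a total function [E S t w], of which only the values at
   [nonempty_fin_subset I S] matter. *)
Definition nonempty_fin_subset (I : set nat) (S : {fset nat}) :=
  S != fset0%fset /\ [set` S] `<=` I.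

Definition intersection_e_collection d (T : measurableType d) (R : realType)
    (F : nat -> set (set T)) (M : set (probability T R)) (I : set nat)
    (H : nat -> set (probability T R)) (E : {fset nat} -> nat -> T -> R) :=
  forall S, nonempty_fin_subset I S ->
    e_process F (intersection_null M H S) (E S).

Definition future_extension_coherent (T : Type) (R : realType)
    (I : set nat) (Iact : nat -> {fset nat})
    (E : {fset nat} -> nat -> T -> R) :=
  forall t (S : {fset nat}), [set` S] `<=` I -> (S `&` Iact t != fset0)%fset ->
    forall w, E (S `&` Iact t)%fset t w <= E S t w.

Definition time_monotone (T : Type) (R : realType)
    (I : set nat) (E : {fset nat} -> nat -> T -> R) :=
  forall t u S, (t <= u)%N -> nonempty_fin_subset I S ->
    forall w, E S t w <= E S u w.

Definition closure_family (T : Type) (R : realType)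
    (Iact : nat -> {fset nat}) (alpha : R)
    (E : {fset nat} -> nat -> T -> R) (t : nat) (w : T) : set {fset nat} :=
  [set A : {fset nat} | (A `<=` Iact t)%fset /\
    forall S : {fset nat}, S != fset0%fset -> (S `<=` Iact t)%fset ->
      FDP [set` S] A <= alpha * E S t w].

Definition represents_by_closure d (T : measurableType d) (R : realType)
    (F : nat -> set (set T)) (M : set (probability T R)) (I : set nat)
    (H : nat -> set (probability T R)) (Iact : nat -> {fset nat})
    (C : nat -> T -> {fset {fset nat}}) (alpha : R)
    (E : {fset nat} -> nat -> T -> R) :=
  [/\ intersection_e_collection F M I H E,
      future_extension_coherent I Iact E,
      time_monotone I E
    & forall t w, [set` C t w] `<=` closure_family Iact alpha E t w].

Definition setwise_persistent (T : Type) (R : realType)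
    (Iact : nat -> {fset nat}) (alpha : R)
    (E : {fset nat} -> nat -> T -> R) :=
  forall w t u, (t <= u)%N ->
    closure_family Iact alpha E t w `<=` closure_family Iact alpha E u w.

(* Main.v *)
Require Import Defs.
From HB Require Import structures.
From mathcomp Require Import all_boot all_order all_algebra finmap.
From mathcomp Require Import all_classical all_reals all_analysis.
From mathcomp Require Import measurable_realfun.

Set Implicit Arguments.
Unset Strict Implicit.
Unset Printing Implicit Defensive.

Import Order.TTheory GRing.Theory Num.Theory.

Local Open Scope classical_set_scope.
Local Open Scope ring_scope.

(** The worst false discovery proportion seen so far is, up to the factor
[alpha], itself the e-process that certifies it.

From error control to e-processes, take [E S t] to be [alpha^-1] times the
largest false discovery proportion [FDP S A] over all candidate sets [A]
proposed up to time [t] ([worst_FDP]).  It increases with [t] and with [S], so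
it is time-monotone and coherent, and it dominates [alpha^-1 * FDP S A] for
each current candidate [A].  If all hypotheses in [S] are true under [P], then
[S] is a set of true nulls and [A] meets [S] in active true nulls only; hence
at any random time whatsoever [E S] is at most [alpha^-1] times the supremum
whose expectation is controlled by [alpha] ([worst_FDP_e_process]).  Only
measurability requires care: as finite families of finite sets form a countable
type, it reduces to measurability of the events on which the candidate family
is a given one.

From e-processes to error control, fix [P] and let [S t] be the set of active
true nulls.  Since [S t] is the part of [S u] that is active at [t], coherence
followed by time-monotonicity gives
[E (S t) t <= E (S u) t <= E (S u) u] for [t <= u].  So [E (S t) t] is a
nondecreasing process, of expectation at most 1 at each deterministic time; by
monotone convergence its supremum has expectation at most 1 too, and that
supremum dominates [alpha^-1] times the worst false discovery proportion
([represents_controls]).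

Persistence is the same two-step inequality read for one rejected set: the
proportion of a subset of [Iact t] with respect to [S] only depends on the part
of [S] active at [t] ([closure_family_persistent]). *)

(** * Measurability of countably valued maps *)

Lemma measurable_prop d (T : measurableType d) (P : Prop) :
  measurable [set _ : T | P].
Proof.
have [p|np] := pselect P; first by rewrite (_ : mkset _ = setT)// -subTset.
by rewrite (_ : mkset _ = set0)// -subset0.
Qed.

Lemma measurable_forall_count d (T : measurableType d) (K : countType)
    (A : K -> set T) :
  (forall k, measurable (A k)) -> measurable [set w | forall k, A k w].
Proof.
move=> mA.
rewrite [X in measurable X](_ : _ =
  \bigcap_n (if choice.unpickle n is Some k then A k else setT)).
  by apply: bigcap_measurableType => n _; case: choice.unpickle.
apply/seteqP; split => [w Aw n _|w Aw k]; first by case: choice.unpickle => /=.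
by have := Aw (choice.pickle k) Logic.I; rewrite choice.pickleK.
Qed.

(** The source of measurability everywhere below: when [f] has countably many
values, anything that depends on [w] through [f w] and through sets that are
measurable once the value of [f] is frozen is measurable. *)
Lemma measurable_countable_piecewise d (T : measurableType d) (K : countType)
    (f : T -> K) (A : K -> set T) :
  (forall k, measurable [set w | f w = k]) -> (forall k, measurable (A k)) ->
  measurable [set w | A (f w) w].
Proof.
move=> mf mA.
rewrite [X in measurable X](_ : _ =
  [set w | forall k, (~` [set w | f w = k] `|` A k) w]).
  apply: measurable_forall_count => k.
  by apply: measurableU => //; exact: measurableC.
apply/seteqP; split => [w Aw k|w Aw] /=.
  by have [<-|] := pselect (f w = k); [right|left].
by have [/(_ erefl)|] := Aw (f w).
Qed.

(** Lets the results on measurable spaces be used in each sigma-algebra of a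
filtration. *)
Lemma sigma_algebra_measurable (T : pointedType) (G : set (set T)) :
  sigma_algebra [set: T] G ->
  forall A : set T, G A = measurable (A : set (g_sigma_algebraType G)).
Proof. by move=> sG A; rewrite /measurable/= (sigma_algebra_id sG). Qed.

(** * False discovery proportions *)

Lemma FDP_ge0 (R : realType) (S : set nat) (A : {fset nat}) :
  0 <= FDP S A :> R.
Proof. by rewrite divr_ge0. Qed.

Lemma FDP_le (R : realType) (S S' : set nat) (A : {fset nat}) :
  (forall i, i \in A -> S i -> S' i) -> FDP S A <= FDP S' A :> R.
Proof.
move=> SS'; rewrite ler_wpM2r ?invr_ge0// ler_nat.
apply/fsubset_leq_card/fsubsetP => i; rewrite !inE/= => /andP[iA iS].
by rewrite iA; apply/mem_set/SS' => //; exact: set_mem.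
Qed.

Lemma FDP_eq0 (R : realType) (S : set nat) (A : {fset nat}) :
  (forall i, i \in A -> ~ S i) -> FDP S A = 0 :> R.
Proof.
move=> SA; apply/eqP; rewrite eq_le FDP_ge0 andbT.
apply: (le_trans (y := FDP set0 A)); first by apply: FDP_le => i /SA.
rewrite /FDP (_ : [fset i in A | i \in set0]%fset = fset0) ?cardfs0 ?mul0r//.
by apply/fsetP => i; rewrite !inE/= in_set0 andbF.
Qed.

(** A set rejected at time [t] consists of hypotheses active at [t], so its
false discovery proportion cannot see those activated later. *)
Lemma FDP_restrict (R : realType) (S U A : {fset nat}) :
  (A `<=` U)%fset -> FDP [set` S] A = FDP [set` (S `&` U)%fset] A :> R.
Proof.
move=> /fsubsetP AU; apply/eqP; rewrite eq_le; apply/andP.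
split; apply: FDP_le => i iA /=; rewrite inE; last by case/andP.
by move=> ->; exact: AU.
Qed.

Lemma max_FDP_le (R : realType) (S : set nat) (K : {fset {fset nat}}) (x : R) :
  0 <= x -> (forall A, A \in K -> FDP S A <= x) -> max_FDP S K <= x.
Proof. by move=> x0 Kx; rewrite /max_FDP big_seq; exact: bigmax_le. Qed.

Lemma FDP_le_max (R : realType) (S : set nat) (K : {fset {fset nat}}) A :
  A \in K -> FDP S A <= max_FDP S K :> R.
Proof. by move=> AK; exact: le_bigmax_seq. Qed.

Lemma max_FDP_ge0 (R : realType) (S : set nat) (K : {fset {fset nat}}) :
  0 <= max_FDP S K :> R.
Proof. exact: bigmax_ge_id. Qed.

Lemma max_FDP_subset (R : realType) (S S' : set nat) (K : {fset {fset nat}}) :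
  (forall A i, A \in K -> i \in A -> S i -> S' i) ->
  max_FDP S K <= max_FDP S' K :> R.
Proof.
move=> SS'; apply: max_FDP_le => [|A AK]; first exact: max_FDP_ge0.
by apply: le_trans (FDP_le_max _ S' AK); apply: FDP_le => i; exact: SS'.
Qed.

Fixpoint worst_FDP {R : realType} (T : Type) (C : nat -> T -> {fset {fset nat}})
    (S : set nat) (t : nat) (w : T) : R :=
  if t is s.+1 then Num.max (worst_FDP C S s w) (max_FDP S (C s.+1 w))
  else max_FDP S (C 0%N w).

Lemma worst_FDP_le (R : realType) (T : Type) (C : nat -> T -> {fset {fset nat}})
    (S : set nat) (t : nat) (w : T) (x : R) :
  (forall s, (s <= t)%N -> max_FDP S (C s w) <= x) -> worst_FDP C S t w <= x.
Proof.
elim: t => [|t IH] Cx /=; first exact: Cx.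
by rewrite ge_max Cx// andbT; apply: IH => s st; apply/Cx/ltnW.
Qed.

Lemma max_FDP_le_worst (R : realType) (T : Type)
    (C : nat -> T -> {fset {fset nat}}) (S : set nat) (s t : nat) (w : T) :
  (s <= t)%N -> max_FDP S (C s w) <= worst_FDP C S t w :> R.
Proof.
elim: t => [|t IH]; first by rewrite leqn0 => /eqP->.
by rewrite leq_eqVlt => /predU1P[->|/IH st]; rewrite /= le_max ?lexx ?st ?orbT.
Qed.

Lemma worst_FDP_ge0 (R : realType) (T : Type)
    (C : nat -> T -> {fset {fset nat}}) (S : set nat) (t : nat) (w : T) :
  0 <= worst_FDP C S t w :> R.
Proof.
exact: le_trans (max_FDP_ge0 _ _ _) (max_FDP_le_worst _ _ _ _ (leqnn t)).
Qed.

(** * Measurability of the candidate families *)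

(** Membership of each of the countably many finite sets is decided at time [t]:
by assumption for subsets of [Iact t], and trivially for the others, which are
never candidates. *)
Lemma candidate_family_fiber d (T : measurableType d) (F : nat -> set (set T))
    (Iact : nat -> {fset nat}) (C : nat -> T -> {fset {fset nat}}) :
  is_filtration F -> candidate_family_process F Iact C ->
  forall t K, F t [set w | C t w = K].
Proof.
move=> [sF _ _] [_ CI CF] t K; rewrite (sigma_algebra_measurable (sF t)).
rewrite [X in measurable X](_ : _ =
  [set w | forall A, (A \in C t w) = (A \in K)]); last first.
  apply/seteqP; split => [w /= ->//|w CK /=].
  exact/fsetP.
apply: measurable_forall_count => A.
have mA : @measurable _ (g_sigma_algebraType (F t)) [set w | A \in C t w].
  have [AI|AI] := boolP (A `<=` Iact t)%fset.
    by rewrite -(sigma_algebra_measurable (sF t)); exact: CF.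
  rewrite (_ : [set w | _] = set0)//.
  by apply/seteqP; split => w //= /CI; exact/negP.
have [AK|AK] := boolP (A \in K).
  rewrite [X in measurable X](_ : _ = [set w | A \in C t w])//.
rewrite [X in measurable X](_ : _ = ~` [set w | A \in C t w]).
  exact: measurableC.
by apply/seteqP; split => w /= => [->//|/negP/negbTE].
Qed.

(** [B] ranges over all sets of reals, not only the measurable ones: the process
is a function of the countably valued history of candidate families.  This
generality is what makes the induction go through, the step replacing [B] by
its preimage under a maximum with a constant. *)
Lemma worst_FDP_preimage d (T : measurableType d) (R : realType)
    (F : nat -> set (set T)) (Iact : nat -> {fset nat})
    (C : nat -> T -> {fset {fset nat}}) (S : set nat) :
  is_filtration F -> candidate_family_process F Iact C ->
  forall t (B : set R), F t (worst_FDP C S t @^-1` B).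
Proof.
move=> Ff CC; have [sF _ ndF] := Ff.
have Cfib t K : @measurable _ (g_sigma_algebraType (F t)) [set w | C t w = K].
  rewrite -(sigma_algebra_measurable (sF t)).
  exact: candidate_family_fiber CC _ _.
elim=> [|t IH] B; rewrite (sigma_algebra_measurable (sF _)).
  apply: (measurable_countable_piecewise
    (A := fun K => [set w | B (max_FDP S K)]) (Cfib 0%N)) => K.
  exact: measurable_prop.
pose A K := worst_FDP C S t @^-1` [set x : R | B (Num.max x (max_FDP S K))].
have mA K : @measurable _ (g_sigma_algebraType (F t.+1)) (A K).
  rewrite -(sigma_algebra_measurable (sF _)); exact: ndF (leqnSn t) _ (IH _).
by have := measurable_countable_piecewise (Cfib t.+1) mA; exact.
Qed.

Lemma measurable_stopped d (T : measurableType d) (R : realType)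
    (F : nat -> set (set T)) (X : nat -> T -> R) (tau : T -> option nat) :
  is_filtration F -> adapted F X -> stopping_time F tau ->
  measurable_fun setT (stopped X tau).
Proof.
move=> [_ Fm _] adX tauF _ B mB; rewrite setTI.
have mtau t : measurable [set w | exists2 s, tau w = Some s & (s <= t)%N].
  exact/Fm/tauF.
apply: (measurable_countable_piecewise (f := tau) (A := fun k =>
  [set w | B (if k is Some t then X t w else 0)])); last first.
  case=> [t|]; first exact/Fm/adX.
  exact: measurable_prop.
case=> [[|t]|].
- rewrite [X in measurable X](_ : _ =
    [set w | exists2 s, tau w = Some s & (s <= 0)%N])//.
  by apply/seteqP; split => w /= => [->|[s ->]]; [exists 0%N|
    rewrite leqn0 => /eqP->].
- rewrite [X in measurable X](_ : _ =
    [set w | exists2 s, tau w = Some s & (s <= t.+1)%N] `\`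
    [set w | exists2 s, tau w = Some s & (s <= t)%N]).
    exact: measurableD.
  apply/seteqP; split => w /= => [->|[[s ->]]].
    by split; [exists t.+1|move=> [s [<-]]; rewrite ltnn].
  rewrite leq_eqVlt => /predU1P[->//|st] []; exists s => //.
- rewrite [X in measurable X](_ : _ = [set w | forall t,
    (~` [set w | exists2 s, tau w = Some s & (s <= t)%N]) w]).
    by apply: measurable_forall_count => t; exact: measurableC.
  apply/seteqP; split => w /= => [-> t []//|tw].
  by case E : (tau w) => [s|//]; have [] := tw s; exists s.
Qed.

Lemma measurable_sup_FDP d (T : measurableType d) (R : realType)
    (F : nat -> set (set T)) (Iact : nat -> {fset nat})
    (C : nat -> T -> {fset {fset nat}}) (S : nat -> set nat) :
  is_filtration F -> candidate_family_process F Iact C ->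
  measurable_fun setT (fun w =>
    ereal_sup (range (fun t => (max_FDP (S t) (C t w))%:E : \bar R))).
Proof.
move=> Ff CC; have [_ Fm _] := Ff.
rewrite (_ : (fun w => _) = fun w =>
    esups (fun t => (max_FDP (S t) (C t w))%:E : \bar R) 0%N); last first.
  apply/funext => w; congr ereal_sup.
  by apply/seteqP; split => _ [t _ <-]; exists t.
apply: (@measurable_fun_esups _ _ _ setT
  (fun t w => (max_FDP (S t) (C t w))%:E) _ 0%N) => t.
apply/measurable_EFinP => _ B mB; rewrite setTI.
apply: (measurable_countable_piecewise (f := C t) (A := fun K =>
  [set _ | B (max_FDP (S t) K)])) => K.
  exact/Fm/(candidate_family_fiber Ff CC).
exact: measurable_prop.
Qed.

(** * From error control to e-processes *)

(** If [P] satisfies all hypotheses in [S], every candidate meets [S] in active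
true nulls, so the process is bounded at all times simultaneously by
[alpha^-1] times the controlled supremum [Z].  Stopping it therefore cannot
push its expectation above [alpha^-1 * alpha = 1]. *)
Lemma worst_FDP_e_process d (T : measurableType d) (R : realType)
    (F : nat -> set (set T)) (M : set (probability T R)) (I : set nat)
    (H : nat -> set (probability T R)) (Iact : nat -> {fset nat})
    (C : nat -> T -> {fset {fset nat}}) (alpha : R) (S : {fset nat}) :
  is_filtration F -> candidate_family_process F Iact C -> 0 < alpha ->
  controls_SupFDR M I H Iact C alpha -> [set` S] `<=` I ->
  e_process F (intersection_null M H S)
    (fun t w => alpha^-1 * worst_FDP C [set` S] t w).
Proof.
move=> Ff CC a0 ctl SI; have [_ CI _] := CC.
have adE : adapted F (fun t w => alpha^-1 * worst_FDP C [set` S] t w : R).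
  move=> t B _.
  exact: (worst_FDP_preimage [set` S] Ff CC t [set x | B (alpha^-1 * x)]).
split => // [t w|P tau [MP HP] tauF _].
  by rewrite mulr_ge0 ?worst_FDP_ge0// invr_ge0 ltW.
pose Z w := ereal_sup (range (fun t =>
  (max_FDP (true_nulls I H P `&` [set` Iact t]) (C t w))%:E : \bar R)).
have Zge t w : ((max_FDP [set` S] (C t w))%:E <= Z w)%E.
  apply: le_trans (ereal_sup_ubound _); last by exists t.
  rewrite lee_fin; apply: max_FDP_subset => A i AinC iA iS.
  split; last exact: (fsubsetP (CI _ _ _ AinC)).
  by split; [exact: SI|exact: HP].
have Z0 w : (0 <= Z w)%E.
  by apply: le_trans (Zge 0%N w); rewrite lee_fin max_FDP_ge0.
have mZ : measurable_fun setT Z by exact: (measurable_sup_FDP _ Ff CC).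
have worstZ t w : ((worst_FDP C [set` S] t w)%:E <= Z w)%E.
  case: (Z w) (Zge ^~ w) => [z| |] // Zge'; rewrite ?leey//.
    by rewrite lee_fin; apply: worst_FDP_le => s _; rewrite -lee_fin.
  by have := Zge' 0%N; rewrite leeNy_eq.
have mstop := measurable_stopped Ff adE tauF.
rewrite unlock; apply: (@le_trans _ _ (\int[P]_w ((alpha^-1)%:E * Z w))%E).
  apply: ge0_le_integral => //.
  - move=> w _; rewrite lee_fin /stopped; case: (tau w) => [t|//].
    by rewrite mulr_ge0 ?worst_FDP_ge0// invr_ge0 ltW.
  - exact/measurable_EFinP.
  - exact: measurable_funeM.
  - move=> w _; rewrite /stopped; case: (tau w) => [t|].
      by rewrite EFinM lee_pmul2l// lte_fin invr_gt0.
    by rewrite mule_ge0// lee_fin invr_ge0 ltW.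
rewrite ge0_integralZl//; last by rewrite lee_fin invr_ge0 ltW.
rewrite (_ : 1 = (alpha^-1)%:E * alpha%:E)%E.
  by rewrite lee_pmul2l// ?lte_fin ?invr_gt0//; exact: ctl.
by rewrite -EFinM mulVf ?gt_eqF.
Qed.

Lemma controls_represents d (T : measurableType d) (R : realType)
    (F : nat -> set (set T)) (M : set (probability T R)) (I : set nat)
    (H : nat -> set (probability T R)) (Iact : nat -> {fset nat})
    (C : nat -> T -> {fset {fset nat}}) (alpha : R) :
  is_filtration F -> candidate_family_process F Iact C -> 0 < alpha ->
  controls_SupFDR M I H Iact C alpha ->
  represents_by_closure F M I H Iact C alpha
    (fun S t w => alpha^-1 * worst_FDP C [set` S] t w).
Proof.
move=> Ff CC a0 ctl; have [_ CI _] := CC.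
split.
- by move=> S [_ SI]; exact: worst_FDP_e_process CC a0 ctl SI.
- move=> t S _ _ w /=; rewrite ler_wpM2l ?invr_ge0 ?(ltW a0)//.
  apply: worst_FDP_le => s st; apply: le_trans (max_FDP_le_worst _ _ _ _ st).
  by apply: max_FDP_subset => A i _ _ /=; rewrite inE => /andP[].
- move=> t u S tu _ w /=; rewrite ler_wpM2l ?invr_ge0 ?(ltW a0)//.
  apply: worst_FDP_le => s st; apply: max_FDP_le_worst.
  exact: leq_trans st tu.
- move=> t w A AinC; split; first exact: (CI _ _ _ AinC).
  move=> S _ _; rewrite mulrA mulfV ?gt_eqF// mul1r.
  exact: le_trans (FDP_le_max _ _ AinC) (max_FDP_le_worst _ _ _ _ (leqnn t)).
Qed.

(** * From e-processes to error control *)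

(** Coherence first enlarges the set of hypotheses at time [t], then
monotonicity moves the time from [t] to [u]; a set [S] with no hypothesis
active at [t] imposes no constraint, its proportion being [0]. *)
Lemma closure_family_persistent d (T : measurableType d) (R : realType)
    (F : nat -> set (set T)) (M : set (probability T R)) (I : set nat)
    (H : nat -> set (probability T R)) (Iact : nat -> {fset nat})
    (alpha : R) (E : {fset nat} -> nat -> T -> R) :
  (forall t u, (t <= u)%N -> (Iact t `<=` Iact u)%fset) ->
  (forall t, [set` Iact t] `<=` I) -> 0 <= alpha ->
  intersection_e_collection F M I H E ->
  future_extension_coherent I Iact E -> time_monotone I E ->
  setwise_persistent Iact alpha E.
Proof.
move=> ndI II a0 eE cohE monE w t u tu A [AI At].
split=> [|S S0 SI]; first exact: fsubset_trans AI (ndI _ _ tu).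
have SsubI : [set` S] `<=` I by move=> i /(fsubsetP SI)/II.
have [St0|St0] := eqVneq (S `&` Iact t)%fset fset0.
  rewrite (FDP_restrict _ _ AI) St0 FDP_eq0//.
  by rewrite mulr_ge0//; have [+ _ _] := eE S (conj S0 SsubI); exact.
rewrite (FDP_restrict _ _ AI) (le_trans (At _ St0 (fsubsetIr _ _)))//.
rewrite ler_wpM2l// (le_trans (cohE _ _ SsubI St0 w))//.
exact: monE.
Qed.

Lemma e_process_expectation_le1 d (T : measurableType d) (R : realType)
    (F : nat -> set (set T)) (H : set (probability T R)) (X : nat -> T -> R)
    (P : probability T R) (t : nat) :
  is_filtration F -> e_process F H X -> H P ->
  (\int[P]_w (X t w)%:E <= 1)%E.
Proof.
move=> [sF _ _] [_ _ eX] HP.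
have := eX P (fun=> Some t) HP; rewrite unlock; apply.
  move=> u; rewrite (sigma_algebra_measurable (sF u)).
  exact: measurable_prop.
rewrite (_ : [set w | _] = setT) ?probability_setT//.
by apply/seteqP; split.
Qed.

Definition active_nulls d (T : measurableType d) (R : realType)
    (H : nat -> set (probability T R)) (Iact : nat -> {fset nat})
    (P : probability T R) (t : nat) : {fset nat} :=
  [fset i in Iact t | `[< H i P >]]%fset.

(** The e-process of the active true nulls, evaluated along the diagonal where
the set grows with time, is nondecreasing and bounds the worst false discovery
proportion, so monotone convergence bounds the expected supremum. *)
Lemma represents_controls d (T : measurableType d) (R : realType)
    (F : nat -> set (set T)) (M : set (probability T R)) (I : set nat)
    (H : nat -> set (probability T R)) (Iact : nat -> {fset nat})
    (C : nat -> T -> {fset {fset nat}}) (alpha : R)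
    (E : {fset nat} -> nat -> T -> R) :
  is_filtration F -> candidate_family_process F Iact C -> 0 <= alpha ->
  (forall t u, (t <= u)%N -> (Iact t `<=` Iact u)%fset) ->
  (forall t, [set` Iact t] `<=` I) ->
  represents_by_closure F M I H Iact C alpha E ->
  controls_SupFDR M I H Iact C alpha.
Proof.
move=> Ff CC a0 ndI II [eE cohE monE CE] P MP.
have [_ Fm _] := Ff.
pose S t := active_nulls H Iact P t.
have SI t : [set` S t] `<=` I by move=> i /=; rewrite !inE => /andP[/II].
have SP t : intersection_null M H (S t) P.
  by split => // i; rewrite !inE => /andP[_ /asboolP].
have ndS t u : (t <= u)%N -> S t = (S u `&` Iact t)%fset.
  move=> tu; apply/fsetP => i; rewrite !inE/=.
  have [it|] := boolP (i \in Iact t); last by rewrite andbF.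
  by rewrite (fsubsetP (ndI _ _ tu) _ it) andbT.
(* No e-value is attached to the empty set; there the false discovery
   proportion vanishes, and so may the bound. *)
pose Y t w := if S t != fset0 then E (S t) t w else 0.
have Y0 t w : 0 <= Y t w.
  rewrite /Y; case: ifPn => // S0.
  by have [+ _ _] := eE _ (conj S0 (SI t)); exact.
have ndY t u w : (t <= u)%N -> Y t w <= Y u w.
  move=> tu; rewrite {1}/Y; case: ifPn => // S0.
  have Su0 : S u != fset0.
    by apply: contraNneq S0 => Su0; rewrite (ndS _ _ tu) Su0 fset0I.
  (* Change the set by coherence at time [t], then the time. *)
  rewrite /Y Su0; apply: (le_trans (y := E (S u) t w)); last exact: monE.
  by rewrite [X in E X](ndS _ _ tu) cohE// -ndS.
have mY t : measurable_fun setT (Y t).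
  rewrite /Y; case: (boolP (S t != fset0)) => S0; last exact: measurable_cst.
  move=> _ B mB; rewrite setTI; have [_ adE _] := eE _ (conj S0 (SI t)).
  exact/Fm/adE.
have intY t : (\int[P]_w (Y t w)%:E <= 1)%E.
  rewrite /Y; case: (boolP (S t != fset0)) => S0; last by rewrite integral0.
  by apply: e_process_expectation_le1 Ff (eE _ _) (SP t); split.
pose g t w := (alpha * Y t w)%:E.
have g0 t w : (0 <= g t w)%E by rewrite lee_fin mulr_ge0.
have mg t : measurable_fun setT (g t).
  by apply/measurable_EFinP; exact: measurable_funM.
have ndg w : {homo g ^~ w : n m / (n <= m)%N >-> (n <= m)%E}.
  by move=> n m nm; rewrite lee_fin ler_wpM2l// ndY.
have cvgg w : g ^~ w @ \oo --> ereal_sup (range (g ^~ w)).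
  exact: ereal_nondecreasing_cvgn.
have FDPg t w :
    ((max_FDP (true_nulls I H P `&` [set` Iact t]) (C t w))%:E <= g t w)%E.
  rewrite lee_fin; apply: max_FDP_le => [|A AinC]; first by rewrite mulr_ge0.
  have [_ At] := CE t w A AinC.
  apply: (le_trans (y := FDP [set` S t] A)).
    by apply: FDP_le => i _ [[_ HP] /= it]; rewrite !inE it; apply/asboolP.
  rewrite /Y; case: ifPn => [S0|/negPn/eqP ->].
    exact: At S0 (fset_sub _ _).
  by rewrite FDP_eq0 ?mulr0.
apply: (@le_trans _ _ (\int[P]_w limn (g ^~ w))%E).
  apply: ge0_le_integral => //.
  - move=> w _; apply: le_trans (ereal_sup_ubound _); last by exists 0%N.
    by rewrite lee_fin max_FDP_ge0.
  - exact: measurable_sup_FDP Ff CC.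
  - by apply: (emeasurable_fun_cvg g) => // w _; rewrite (cvg_lim _ (cvgg w)).
  - move=> w _; rewrite (cvg_lim _ (cvgg w))//.
    apply: ge_ereal_sup => _ [t _ <-].
    by apply: le_trans (FDPg t w) (ereal_sup_ubound _); exists t.
rewrite monotone_convergence//.
apply: lime_le.
  apply: ereal_nondecreasing_is_cvgn => n m nm.
  by apply: ge0_le_integral => // w _; exact: ndg.
apply: nearW => t; rewrite /g.
under eq_integral do rewrite EFinM.
rewrite ge0_integralZl//; last 2 first.
  exact/measurable_EFinP.
  by move=> w _; rewrite lee_fin.
by rewrite -[leRHS]mule1 lee_wpmul2l.
Qed.

Theorem theorem3p11 (d : measure_display) (T : measurableType d)
    (R : realType) (F : nat -> set (set T)) (M : set (probability T R))
    (I : set nat) (H : nat -> set (probability T R))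
    (Iact : nat -> {fset nat}) (C : nat -> T -> {fset {fset nat}}) (alpha : R)
    (filtrationF : is_filtration F)
    (subHM : forall i, I i -> H i `<=` M)
    (Iact_nondecreasing : forall t u, (t <= u)%N -> (Iact t `<=` Iact u)%fset)
    (Iact_exhausts : \bigcup_t [set` Iact t] = I)
    (alpha_gt0 : 0 < alpha) (alpha_le1 : alpha <= 1)
    (candidatesC : candidate_family_process F Iact C) :
  (controls_SupFDR M I H Iact C alpha <->
     exists E : {fset nat} -> nat -> T -> R,
       represents_by_closure F M I H Iact C alpha E) /\
  (forall E : {fset nat} -> nat -> T -> R,
     represents_by_closure F M I H Iact C alpha E ->
     setwise_persistent Iact alpha E).
Proof.
have II t : [set` Iact t] `<=` I by rewrite -Iact_exhausts => i it; exists t.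
split; first split=> [ctl|[E repE]].
- by eexists; exact: controls_represents filtrationF candidatesC alpha_gt0 ctl.
- exact: represents_controls filtrationF candidatesC (ltW alpha_gt0)
    Iact_nondecreasing II repE.
- move=> E [eE cohE monE _].
  exact: closure_family_persistent Iact_nondecreasing II (ltW alpha_gt0)
    eE cohE monE.
Qed.
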